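(* Consider $\mathrm{SL}_2(\mathbb{N}_0)$ as a submonoid of the group $\mathrm{PSL}_2(\mathbb{Z})$, acting on $\mathbb{P}^1(\mathbb{Q})$ by Möbius transformations. The orbit map $\gamma\mapsto\gamma(1)$ defines a bijection $\Omega:\mathrm{SL}_2(\mathbb{N}_0)\to\mathbb{Q}_{>0}$. Furthermore, $\Omega$ defines an isomorphism of directed graphs between the directed Cayley tree $C(\mathrm{SL}_2(\mathbb{N}_0),\{L,R\})$ and the Calkin-Wilf tree, where the vertex set of the Calkin-Wilf tree is identified with $\mathbb{Q}_{>0}$ via the labels and each of its edges is oriented as pointing away from $1$.
   Context: $\mathbb{N}_0$ is the set of nonnegative integers. $\mathrm{SL}_2(\mathbb{N}_0)$ is the monoid of $2\times 2$ matrices with entries in $\mathbb{N}_0$ and determinant $1$, under matrix multiplication; the composite $\mathrm{SL}_2(\mathbb{N}_0)\to\mathrm{SL}_2(\mathbb{Z})\to\mathrm{PSL}_2(\mathbb{Z})$ is injective. The class of $\begin{pmatrix}a&b\\c&d\end{pmatrix}$ acts on $\mathbb{P}^1(\mathbb{Q})=\mathbb{Q}\cup\{\infty\}$ by $z\mapsto\frac{az+b}{cz+d}$. Put $L=\begin{pmatrix}1&0\\1&1\end{pmatrix}$ and $R=\begin{pmatrix}1&1\\0&1\end{pmatrix}$; these generate the monoid $\mathrm{SL}_2(\mathbb{N}_0)$. A directed graph is a quadruple $(V,E,s,t)$ with sets $V$ (vertices), $E$ (edges) and maps $s,t:E\to V$ (source, target). For a monoid $M$ with generating set $A\subseteq M$,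 the directed Cayley graph $C(M,A)$ has $V=M$, $E=M\times A$, $s(\mu,\alpha)=\mu$, $t(\mu,\alpha)=\alpha\mu$. The Calkin-Wilf tree is the infinite rooted binary tree with nodes labelled by positive rationals as follows: the root is labelled $\frac11$, and if a node is labelled $\frac pq$ (with $p,q$ coprime positive integers), its left child is labelled $\frac{p}{p+q}$ and its right child $\frac{p+q}{q}$. Every positive rational occurs exactly once as a label, so the vertex set can be identified with $\mathbb{Q}_{>0}$. *)

(* Defs.v *)
From HB Require Import structures.
From mathcomp Require Import all_boot all_order all_algebra.
From mathcomp Require Import ring.

Set Implicit Arguments.
Unset Strict Implicit.
Unset Printing Implicit Defensive.

Import Order.TTheory GRing.Theory Num.Theory.
Local Open Scope ring_scope.
Local Open Scope quotient_scope.

Record SL2Z := MkSL2Z {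
  SL2Z_mx :> 'M[int]_2;
  SL2Z_det1 : \det SL2Z_mx == 1 }.

HB.instance Definition _ := [isSub for SL2Z_mx].
HB.instance Definition _ := [Choice of SL2Z by <:].

Lemma SL2Z_det (g : SL2Z) : \det g = 1.
Proof. exact/eqP/SL2Z_det1. Qed.

Lemma SL2Z_unit (g : SL2Z) : SL2Z_mx g \in unitmx.
Proof. by rewrite unitmxE SL2Z_det unitr1. Qed.

Fact SL2Z_one_subproof : \det (1%:M : 'M[int]_2) == 1.
Proof. by rewrite det1. Qed.

Fact SL2Z_mul_subproof (g h : SL2Z) : \det (g *m h) == 1.
Proof. by rewrite det_mulmx !SL2Z_det mulr1. Qed.

Fact SL2Z_inv_subproof (g : SL2Z) : \det (invmx g) == 1.
Proof. by rewrite det_inv SL2Z_det invr1. Qed.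

Definition SL2Z_one := MkSL2Z SL2Z_one_subproof.
Definition SL2Z_mul (g h : SL2Z) := MkSL2Z (SL2Z_mul_subproof g h).
Definition SL2Z_inv (g : SL2Z) := MkSL2Z (SL2Z_inv_subproof g).

Fact SL2Z_mulA : associative SL2Z_mul.
Proof. by move=> g h k; apply: val_inj; rewrite /= mulmxA. Qed.

Fact SL2Z_mul1g : left_id SL2Z_one SL2Z_mul.
Proof. by move=> g; apply: val_inj; rewrite /= mul1mx. Qed.

Fact SL2Z_mulg1 : right_id SL2Z_one SL2Z_mul.
Proof. by move=> g; apply: val_inj; rewrite /= mulmx1. Qed.

Fact SL2Z_mulVg : left_inverse SL2Z_one SL2Z_inv SL2Z_mul.
Proof. by move=> g; apply: val_inj; rewrite /= mulVmx ?SL2Z_unit. Qed.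

Fact SL2Z_mulgV : right_inverse SL2Z_one SL2Z_inv SL2Z_mul.
Proof. by move=> g; apply: val_inj; rewrite /= mulmxV ?SL2Z_unit. Qed.

HB.instance Definition _ := isGroup.Build SL2Z
  SL2Z_mulA SL2Z_mul1g SL2Z_mulg1 SL2Z_mulVg SL2Z_mulgV.

Lemma SL2Z_mxM (g h : SL2Z) : SL2Z_mx (g * h)%g = g *m h.
Proof. by []. Qed.

Definition eq_up_to_sign (g h : SL2Z) : bool :=
  (g == h :> 'M[int]_2) || (SL2Z_mx g == - SL2Z_mx h).

Lemma eq_up_to_signP (g h : SL2Z) :
  reflect (exists b : bool, SL2Z_mx g = (-1) ^+ b *: SL2Z_mx h)
          (eq_up_to_sign g h).
Proof.
apply: (iffP orP) => [[/eqP e|/eqP e]|[[] e]].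
- by exists false; rewrite expr0 scale1r.
- by exists true; rewrite expr1 scaleN1r.
- by right; rewrite e expr1 scaleN1r.
- by left; rewrite e expr0 scale1r.
Qed.

Fact eq_up_to_sign_refl : reflexive eq_up_to_sign.
Proof. by move=> g; rewrite /eq_up_to_sign eqxx. Qed.

Fact eq_up_to_sign_sym : symmetric eq_up_to_sign.
Proof.
move=> g h; rewrite /eq_up_to_sign eq_sym; congr (_ || _).
by rewrite -eqr_oppLR eq_sym.
Qed.

Fact eq_up_to_sign_trans : transitive eq_up_to_sign.
Proof.
move=> h g k /eq_up_to_signP[b eg] /eq_up_to_signP[c eh].
by apply/eq_up_to_signP; exists (b (+) c); rewrite eg eh scalerA signr_addb.
Qed.

Canonical eq_up_to_sign_equiv :=
  EquivRel eq_up_to_sign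
    eq_up_to_sign_refl eq_up_to_sign_sym eq_up_to_sign_trans.

Definition PSL2Z := {eq_quot eq_up_to_sign}.
HB.instance Definition _ := Choice.on PSL2Z.
HB.instance Definition _ := EqQuotient.on PSL2Z.

Definition PSL2Z_class (g : SL2Z) : PSL2Z := \pi_PSL2Z g.

Lemma PSL2Z_classP (g h : SL2Z) :
  reflect (exists b : bool, SL2Z_mx g = (-1) ^+ b *: SL2Z_mx h)
          (PSL2Z_class g == PSL2Z_class h).
Proof. by rewrite /PSL2Z_class eqmodE; apply: eq_up_to_signP. Qed.

Lemma PSL2Z_repr (g : SL2Z) :
  exists b : bool, SL2Z_mx (repr (PSL2Z_class g)) = (-1) ^+ b *: SL2Z_mx g.
Proof. by apply/PSL2Z_classP; rewrite /PSL2Z_class reprK. Qed.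

Definition PSL2Z_one : PSL2Z := PSL2Z_class 1%g.
Definition PSL2Z_mul (x y : PSL2Z) : PSL2Z :=
  PSL2Z_class (repr x * repr y)%g.
Definition PSL2Z_inv (x : PSL2Z) : PSL2Z := PSL2Z_class (repr x)^-1%g.

Lemma PSL2Z_mulE (g h : SL2Z) :
  PSL2Z_mul (PSL2Z_class g) (PSL2Z_class h) = PSL2Z_class (g * h)%g.
Proof.
have [b eg] := PSL2Z_repr g; have [c eh] := PSL2Z_repr h.
apply/eqP/PSL2Z_classP; exists (b (+) c).
by rewrite !SL2Z_mxM eg eh -scalemxAl -scalemxAr scalerA signr_addb.
Qed.

Lemma PSL2Z_classK (x : PSL2Z) : PSL2Z_class (repr x) = x.
Proof. exact: reprK. Qed.

Fact PSL2Z_mulA : associative PSL2Z_mul.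
Proof.
move=> x y z; rewrite -(PSL2Z_classK x) -(PSL2Z_classK y) -(PSL2Z_classK z).
by rewrite !PSL2Z_mulE mulgA.
Qed.

Fact PSL2Z_mul1g : left_id PSL2Z_one PSL2Z_mul.
Proof. by move=> x; rewrite -(PSL2Z_classK x) PSL2Z_mulE mul1g. Qed.

Fact PSL2Z_mulg1 : right_id PSL2Z_one PSL2Z_mul.
Proof. by move=> x; rewrite -(PSL2Z_classK x) PSL2Z_mulE mulg1. Qed.

Fact PSL2Z_mulVg : left_inverse PSL2Z_one PSL2Z_inv PSL2Z_mul.
Proof. by move=> x; rewrite -{2}(PSL2Z_classK x) PSL2Z_mulE mulVg. Qed.

Fact PSL2Z_mulgV : right_inverse PSL2Z_one PSL2Z_inv PSL2Z_mul.
Proof. by move=> x; rewrite -{1}(PSL2Z_classK x) PSL2Z_mulE mulgV. Qed.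

HB.instance Definition _ := isGroup.Build PSL2Z
  PSL2Z_mulA PSL2Z_mul1g PSL2Z_mulg1 PSL2Z_mulVg PSL2Z_mulgV.

Lemma PSL2Z_classM (g h : SL2Z) :
  PSL2Z_class (g * h)%g = (PSL2Z_class g * PSL2Z_class h)%g.
Proof. exact: esym (PSL2Z_mulE g h). Qed.

HB.instance Definition _ := isUMagmaMorphism.Build SL2Z PSL2Z PSL2Z_class
  (erefl, PSL2Z_classM).

Definition nneg_entries : {pred SL2Z} :=
  [pred g : SL2Z | SL2Z_mx g \is a mxOver Num.nneg].

Fact nneg_entries_monoid_closed : monoid_closed nneg_entries.
Proof.
split=> [|g h]; rewrite !inE; last exact: mxOverM.
by apply: mxOver_scalar; rewrite ?rpred0 ?rpred1.
Qed.

Record SL2N0 := MkSL2N0 {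
  SL2N0_SL2Z :> SL2Z;
  SL2N0_nneg : SL2N0_SL2Z \in nneg_entries }.

HB.instance Definition _ := [isSub for SL2N0_SL2Z].
HB.instance Definition _ := [Choice of SL2N0 by <:].
HB.instance Definition _ :=
  SubChoice_isSubMonoid.Build SL2Z nneg_entries SL2N0
    nneg_entries_monoid_closed.

Definition SL2N0_PSL2Z (g : SL2N0) : PSL2Z := PSL2Z_class g.

Fact SL2N0_PSL2Z_morph : monoid.monoid_morphism SL2N0_PSL2Z.
Proof.
split=> [//|g h]; exact: PSL2Z_classM.
Qed.

HB.instance Definition _ :=
  isUMagmaMorphism.Build SL2N0 PSL2Z SL2N0_PSL2Z SL2N0_PSL2Z_morph.

Lemma SL2N0_PSL2Z_inj : injective SL2N0_PSL2Z.
Proof.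
move=> g h /eqP/PSL2Z_classP[[] /=]; last first.
  by rewrite scale1r => e; do 2!apply: val_inj.
rewrite expr1 scaleN1r => e.
have e0 : SL2Z_mx g = 0.
  apply/matrixP => i j; apply/eqP; rewrite mxE eq_le.
  have /mxOverP/(_ i j) := SL2N0_nneg g; rewrite nnegrE => ->.
  have /mxOverP/(_ i j) := SL2N0_nneg h; rewrite nnegrE => hij.
  by rewrite e mxE oppr_le0 hij.
by have := SL2Z_det g; rewrite e0 det0.
Qed.

(* [None] is the point at infinity. *)
Definition P1Q := option rat.

Definition mobius_map (a b c d : rat) (z : P1Q) : P1Q :=
  if z is Some x then
    if c * x + d == 0 then None else Some ((a * x + b) / (c * x + d))
  else
    if c == 0 then None else Some (a / c).

Definition mobius (g : SL2Z) (z : P1Q) : P1Q :=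
  mobius_map (g 0 0)%:~R (g 0 1)%:~R (g 1 0)%:~R (g 1 1)%:~R z.

Definition PSL2Z_act (x : PSL2Z) (z : P1Q) : P1Q := mobius (repr x) z.

Lemma PSL2Z_actE (g : SL2Z) (z : P1Q) :
  PSL2Z_act (PSL2Z_class g) z = mobius g z.
Proof.
rewrite /PSL2Z_act /mobius /mobius_map; have [b ->] := PSL2Z_repr g.
rewrite !mxE !rmorphM /= !rmorph_sign; set s : rat := (-1) ^+ b.
have s0 : s != 0 by rewrite signr_eq0.
case: z => [x|].
  rewrite -!mulrA -!mulrDr mulf_eq0 (negPf s0) /=.
  by case: ifP => // _; rewrite -mulf_div divff // mul1r.
rewrite mulf_eq0 (negPf s0) /=.
by case: ifP => // _; rewrite -mulf_div divff // mul1r.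
Qed.

Lemma mobius1 (z : P1Q) : mobius 1%g z = z.
Proof.
rewrite /mobius /mobius_map /= !mxE /=.
by case: z => [x|] //=; rewrite mul0r add0r mul1r addr0 oner_eq0 divr1.
Qed.

Lemma SL2Z_det_entries (g : SL2Z) :
  (g 0 0)%:~R * (g 1 1)%:~R - (g 0 1)%:~R * (g 1 0)%:~R = 1 :> rat.
Proof.
have := SL2Z_det g; rewrite (expand_det_row _ 0) !big_ord_recl big_ord0 addr0.
rewrite /cofactor !det_mx11 !mxE /= expr0 expr1 mul1r mulN1r mulrN => e.
rewrite -!rmorphM -rmorphB -[RHS](rmorph1 intr) -e /=.
by congr ((g _ _ * g _ _ - g _ _ * g _ _)%:~R); apply: val_inj.
Qed.

Lemma mobiusM (g h : SL2Z) (z : P1Q) :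
  mobius (g * h)%g z = mobius g (mobius h z).
Proof.
have mulE i j : ((g * h)%g i j)%:~R =
    (g i 0)%:~R * (h 0 j)%:~R + (g i 1)%:~R * (h 1 j)%:~R :> rat.
  rewrite SL2Z_mxM mxE !big_ord_recl big_ord0 addr0 rmorphD !rmorphM.
  by congr (_ * _ + (g _ _)%:~R * (h _ _)%:~R); apply: val_inj.
have := SL2Z_det_entries h; rewrite /mobius /mobius_map !mulE.
move: (g 0 0)%:~R (g 0 1)%:~R (g 1 0)%:~R (g 1 1)%:~R => p q r s.
move: (h 0 0)%:~R (h 0 1)%:~R (h 1 0)%:~R (h 1 1)%:~R => a b c d det1.
have [N [D [-> ND0]]] : exists N D : rat,
    (if z is Some x then
       if c * x + d == 0 then None else Some ((a * x + b) / (c * x + d))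
     else if c == 0 then None else Some (a / c)) =
    (if D == 0 then None else Some (N / D)) /\
    (D = 0 -> N != 0) /\
    (if z is Some x then
       if (r * a + s * c) * x + (r * b + s * d) == 0 then None
       else Some (((p * a + q * c) * x + (p * b + q * d)) /
                  ((r * a + s * c) * x + (r * b + s * d)))
     else if r * a + s * c == 0 then None
       else Some ((p * a + q * c) / (r * a + s * c))) =
    (if r * N + s * D == 0 then None
     else Some ((p * N + q * D) / (r * N + s * D))).
  case: z => [x|]; last first.
    exists a, c; split=> //; split=> // c0.
    by apply/eqP => a0; move/eqP: det1; rewrite c0 a0 !(mul0r, mulr0) subrr
      eq_sym oner_eq0.
  exists (a * x + b), (c * x + d); split=> //; split=> [D0|].
    apply/eqP => N0; have : a * (c * x + d) - c * (a * x + b) = 1.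
      by rewrite -det1; ring.
    by move/eqP; rewrite D0 N0 !mulr0 subrr eq_sym oner_eq0.
  have -> : (r * a + s * c) * x + (r * b + s * d) =
            r * (a * x + b) + s * (c * x + d) by ring.
  by have -> : (p * a + q * c) * x + (p * b + q * d) =
            p * (a * x + b) + q * (c * x + d) by ring.
case: ND0 => N0 ->; have [D0|D0] := eqVneq D 0.
  rewrite D0 !mulr0 !addr0 mulf_eq0 (negPf (N0 D0)) orbF.
  by case: ifP => // _; rewrite -mulf_div divff ?mulr1 ?N0.
have -> : r * (N / D) + s = (r * N + s * D) / D by field.
have -> : p * (N / D) + q = (p * N + q * D) / D by field.
rewrite mulf_eq0 invr_eq0 (negPf D0) orbF; case: ifPn => // rs0.
by congr Some; field; rewrite D0.
Qed.

Lemma PSL2Z_act1 (z : P1Q) : PSL2Z_act 1%g z = z.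
Proof. by rewrite (PSL2Z_actE 1%g) mobius1. Qed.

Lemma PSL2Z_actM (x y : PSL2Z) (z : P1Q) :
  PSL2Z_act (x * y)%g z = PSL2Z_act x (PSL2Z_act y z).
Proof.
rewrite -(PSL2Z_classK x) -(PSL2Z_classK y) -PSL2Z_classM.
by rewrite !PSL2Z_actE mobiusM.
Qed.

Definition SL2N0_act (g : SL2N0) (z : P1Q) : P1Q :=
  PSL2Z_act (SL2N0_PSL2Z g) z.

Definition mx22 (a b c d : int) : 'M[int]_2 :=
  \matrix_(i < 2, j < 2)
    if i == 0 then if j == 0 then a else b else if j == 0 then c else d.

Lemma det_mx22 a b c d : \det (mx22 a b c d) = a * d - b * c.
Proof.
rewrite (expand_det_row _ 0) !big_ord_recl big_ord0 addr0.
by rewrite /cofactor !det_mx11 !mxE /= expr0 expr1 mul1r mulN1r mulrN.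
Qed.

Lemma mx22_nneg a b c d :
  0 <= a -> 0 <= b -> 0 <= c -> 0 <= d -> mx22 a b c d \is a mxOver Num.nneg.
Proof.
move=> a0 b0 c0 d0; apply/mxOverP => i j; rewrite mxE nnegrE.
by case: (i == 0); case: (j == 0).
Qed.

Fact L_det_subproof : \det (mx22 1 0 1 1) == 1.
Proof. by rewrite det_mx22. Qed.
Fact L_nneg_subproof : MkSL2Z L_det_subproof \in nneg_entries.
Proof. by rewrite inE /= mx22_nneg. Qed.
Definition L : SL2N0 := MkSL2N0 L_nneg_subproof.

Fact R_det_subproof : \det (mx22 1 1 0 1) == 1.
Proof. by rewrite det_mx22. Qed.
Fact R_nneg_subproof : MkSL2Z R_det_subproof \in nneg_entries.
Proof. by rewrite inE /= mx22_nneg. Qed.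
Definition R : SL2N0 := MkSL2N0 R_nneg_subproof.

Record digraph := Digraph {
  vertex : Type;
  edge : Type;
  source : edge -> vertex;
  target : edge -> vertex }.

Definition digraph_isomorphism (G H : digraph)
    (fV : vertex G -> vertex H) (fE : edge G -> edge H) : Prop :=
  [/\ bijective fV, bijective fE,
      forall e, source (fE e) = fV (source e)
    & forall e, target (fE e) = fV (target e)].

Definition cayley_digraph (M : monoidType) (A : {pred M}) : digraph :=
  {| vertex := M;
     edge := M * {a : M | a \in A};
     source := fun e => e.1;
     target := fun e => (val e.2 * e.1)%g |}.

(* When [f] is bijective, this is [G] with each vertex [v] identified with
   [f v]. *)
Definition relabel (G : digraph) (X : Type) (f : vertex G -> X) : digraph :=
  {| vertex := X;
     edge := edge G;
     source := f \o @source G;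
     target := f \o @target G |}.

Record Qpos := MkQpos {
  Qpos_rat :> rat;
  Qpos_gt0 : 0 < Qpos_rat }.

HB.instance Definition _ := [isSub for Qpos_rat].
HB.instance Definition _ := [Choice of Qpos by <:].

Lemma Qpos_numq_gt0 (x : Qpos) : 0 < (numq x)%:~R :> rat.
Proof. by rewrite ltr0z numq_gt0 Qpos_gt0. Qed.

Lemma Qpos_denq_gt0 (x : Qpos) : 0 < (denq x)%:~R :> rat.
Proof. by rewrite ltr0z denq_gt0. Qed.

Fact root_label_subproof : 0 < 1 :> rat.
Proof. exact: ltr01. Qed.

Fact left_label_subproof (x : Qpos) :
  0 < (numq x)%:~R / (numq x + denq x)%:~R :> rat.
Proof.
by rewrite divr_gt0 ?rmorphD ?addr_gt0 ?Qpos_numq_gt0 ?Qpos_denq_gt0.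
Qed.

Fact right_label_subproof (x : Qpos) :
  0 < (numq x + denq x)%:~R / (denq x)%:~R :> rat.
Proof.
by rewrite divr_gt0 ?rmorphD ?addr_gt0 ?Qpos_numq_gt0 ?Qpos_denq_gt0.
Qed.

Definition root_label : Qpos := MkQpos root_label_subproof.
(* As [denq x] is positive, [numq x] and [denq x] are the coprime positive
   integers [p] and [q] with [x = p / q]. *)
Definition left_label (x : Qpos) : Qpos := MkQpos (left_label_subproof x).
Definition right_label (x : Qpos) : Qpos := MkQpos (right_label_subproof x).

Inductive side := Left | Right.

(* A node is the path to it from the root [::], most recent step first. *)
Definition node := seq side.

Definition child (w : node) (d : side) : node := d :: w.

Fixpoint label (w : node) : Qpos :=
  match w with
  | [::] => root_label
  | Left :: u => left_label (label u)
  | Right :: u => right_label (label u)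
  end.

Definition calkin_wilf_tree : digraph :=
  {| vertex := node;
     edge := node * side;
     source := fun e => e.1;
     target := fun e => child e.1 e.2 |}.

Definition calkin_wilf_digraph : digraph :=
  @relabel calkin_wilf_tree Qpos label.

(* Main.v *)
Require Import Defs.
From mathcomp Require Import all_boot all_order all_algebra.
From mathcomp Require Import zify ring.
Import Order.TTheory GRing.Theory Num.Theory.
Local Open Scope ring_scope.

(** Write [x] for a label.  In terms of rational numbers, the left child of [x]
    is labelled [x / (x + 1)] and the right child [x + 1]; these are exactly the
    images of [x] under the Moebius transformations [L] and [R].  Hence, if the
    path [w] is read as a product of generators [path_mx w], the orbit map
    sends [path_mx w] to [label w] ([orbit_path_mx]).

    Two descents of the same shape finish the proof.

    - On labels: the root [1], the left labels ([< 1]) and the right labels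
      ([> 1]) are pairwise disjoint, and passing to a child is injective; so
      [label] is injective.  It is surjective by the subtractive Euclidean
      algorithm, run on a fraction [p / q].
    - On matrices: any [g] in the monoid is [1], or [L * h], or [R * h]
      ([SL2N0_case]), because of two comparable rows one can be subtracted from
      the other, and incomparable rows force [g = 1].  As the orbit point of [g]
      tells these three cases apart, it determines [g], letter by letter along
      the path to that label ([orbit_eq_label]).

    So the orbit map and [label] are bijective, and an edge [(g, A)] of the
    Cayley graph corresponds to the edge from the node labelled [g(1)] in the
    direction that [A] encodes. *)

(** * Labels of the Calkin-Wilf tree *)

Definition child_label (s : side) : Qpos -> Qpos :=
  if s is Left then left_label else right_label.

Lemma label_cons (s : side) (w : node) :
  label (s :: w) = child_label s (label w).
Proof. by case: s. Qed.

Lemma left_labelE (x : Qpos) : Qpos_rat (left_label x) = Qpos_rat x / (Qpos_rat x + 1).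
Proof.
have p0 := Qpos_numq_gt0 x; have q0 := Qpos_denq_gt0 x.
rewrite /= rmorphD /=; have := divq_num_den (Qpos_rat x).
move: (numq _)%:~R (denq _)%:~R p0 q0 => p q p0 q0 <-.
by field; rewrite !gt_eqF ?addr_gt0.
Qed.

Lemma right_labelE (x : Qpos) : Qpos_rat (right_label x) = Qpos_rat x + 1.
Proof.
have q0 := Qpos_denq_gt0 x.
rewrite /= rmorphD /=; have := divq_num_den (Qpos_rat x).
move: (numq _)%:~R (denq _)%:~R q0 => p q q0 <-.
by field; rewrite gt_eqF.
Qed.

Lemma left_label_lt1 (x : Qpos) : left_label x < 1 :> rat.
Proof.
have x0 := Qpos_gt0 x.
by rewrite left_labelE ltr_pdivrMr ?addr_gt0 // mul1r ltrDl.
Qed.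

Lemma right_label_gt1 (x : Qpos) : 1 < right_label x :> rat.
Proof. by rewrite right_labelE ltrDr Qpos_gt0. Qed.

Lemma child_label_neq_root (s : side) (x : Qpos) :
  child_label s x <> root_label.
Proof.
move/(congr1 Qpos_rat); case: s => /= e.
  by have := left_label_lt1 x; rewrite /= e ltxx.
by have := right_label_gt1 x; rewrite /= e ltxx.
Qed.

Lemma child_label_inj (s t : side) (x y : Qpos) :
  child_label s x = child_label t y -> s = t /\ x = y.
Proof.
have x0 := Qpos_gt0 x; have y0 := Qpos_gt0 y.
have lt_lr u v : left_label u < right_label v :> rat.
  exact: lt_trans (left_label_lt1 u) (right_label_gt1 v).
move/(congr1 Qpos_rat); case: s t => [] [] e.
- split=> //; apply: val_inj => /=; move: e; rewrite !left_labelE => /eqP.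
  rewrite eqr_div; [move/eqP | by rewrite gt_eqF ?addr_gt0 ..].
  rewrite !mulrDr !mulr1 mulrC; exact: addrI.
- by have := lt_lr x y; rewrite e ltxx.
- by have := lt_lr y x; rewrite e ltxx.
- split=> //; apply: val_inj => /=; move: e; rewrite !right_labelE.
  exact: addIr.
Qed.

Lemma label_inj : injective label.
Proof.
elim=> [|s u IHu] [|t v] //; rewrite ?label_cons.
- by move/esym/child_label_neq_root.
- by move/child_label_neq_root.
- by case/child_label_inj=> -> /IHu ->.
Qed.

(** The subtractive Euclidean algorithm: subtracting the smaller of numerator
    and denominator from the larger leads to the label of the parent.  Writing
    them as successors keeps both positive, and allowing unreduced fractions
    avoids carrying coprimality through the recursion.  The conclusion is a
    sigma type because the inverse of [label] is extracted from it. *)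
Lemma label_surj_frac (p q : nat) :
  {w : node | label w = p.+1%:R / q.+1%:R :> rat}.
Proof.
have [n] := ubnP (p + q); elim: n p q => // n IHn p q lt_n.
have nz k : k.+1%:R != 0 :> rat by rewrite pnatr_eq0.
have [lt_pq|lt_qp|->] := ltngtP p q; last by exists [::]; rewrite divff.
- have [|w lw] := IHn p (q - p).-1; first by lia.
  exists (Left :: w); rewrite label_cons left_labelE lw.
  have -> : q.+1%:R = p.+1%:R + (q - p).-1.+1%:R :> rat.
    by rewrite -natrD; congr _%:R; lia.
  by field; rewrite !nat1r -natrD !pnatr_eq0.
- have [|w lw] := IHn (p - q).-1 q; first by lia.
  exists (Right :: w); rewrite label_cons right_labelE lw.
  have -> : p.+1%:R = (p - q).-1.+1%:R + q.+1%:R :> rat.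
    by rewrite -natrD; congr _%:R; lia.
  by field; rewrite nat1r nz.
Qed.

Lemma label_surj (x : Qpos) : {w : node | label w = x}.
Proof.
have p0 : 0 < numq x by rewrite numq_gt0 Qpos_gt0.
have q0 : 0 < denq x by rewrite denq_gt0.
have [w lw] := label_surj_frac `|numq x|.-1 `|denq x|.-1.
exists w; apply: val_inj; rewrite /= lw !prednK ?absz_gt0 ?gt_eqF //.
by rewrite !natr_absz !gtr0_norm // divq_num_den.
Qed.

Definition node_of (x : Qpos) : node := sval (label_surj x).

Lemma node_ofK : cancel node_of label.
Proof. by move=> x; rewrite /node_of; case: (label_surj x). Qed.

Lemma labelK : cancel label node_of.
Proof. by move=> w; apply: label_inj; rewrite node_ofK. Qed.

(** * Factoring elements of the monoid *)

Definition gen (s : side) : SL2N0 := if s is Left then L else R.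

Fixpoint path_mx (w : node) : SL2N0 :=
  if w is s :: u then (gen s * path_mx u)%g else 1%g.

Lemma SL2N0_ge0 (g : SL2N0) i j : 0 <= g i j.
Proof. by have /mxOverP/(_ i j) := SL2N0_nneg g; rewrite nnegrE. Qed.

Lemma SL2Z_det_int (g : SL2Z) : g 0 0 * g 1 1 - g 0 1 * g 1 0 = 1.
Proof.
by apply: (@intr_inj rat); rewrite rmorphB !rmorphM; exact: SL2Z_det_entries.
Qed.

Lemma mx22E (A : 'M[int]_2) : A = mx22 (A 0 0) (A 0 1) (A 1 0) (A 1 1).
Proof.
apply/matrixP => i j; rewrite mxE.
by case: i j => [[|[|//]] i] [[|[|//]] j]; congr (A _ _); apply: val_inj.
Qed.

Lemma mulmx22 (a b c d a' b' c' d' : int) :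
  mx22 a b c d *m mx22 a' b' c' d' =
  mx22 (a * a' + b * c') (a * b' + b * d')
       (c * a' + d * c') (c * b' + d * d').
Proof.
apply/matrixP => i j; rewrite !mxE !big_ord_recl big_ord0 addr0 !mxE.
by case: ifP => _; case: ifP.
Qed.

Lemma SL2N0_mx22 (a b c d : int) :
    a * d - b * c = 1 -> 0 <= a -> 0 <= b -> 0 <= c -> 0 <= d ->
  {g : SL2N0 | SL2Z_mx g = mx22 a b c d}.
Proof.
move=> det1 a0 b0 c0 d0.
have detg : \det (mx22 a b c d) == 1 by rewrite det_mx22 det1.
have gN : MkSL2Z detg \in nneg_entries by rewrite inE /= mx22_nneg.
by exists (MkSL2N0 gN).
Qed.

(** If one row dominates the other entrywise, subtracting it leaves a matrix
    of the monoid.  Opposite strict inequalities in the two columns are either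
    incompatible with a positive determinant, or make the determinant at least
    [(c + 1) * (b + 1) - b * c = 1 + b + c], which forces the identity. *)
Lemma SL2N0_case (g : SL2N0) : g = 1%g \/ exists s h, g = (gen s * h)%g.
Proof.
have := SL2Z_det_int g; have gE := mx22E g.
have a0 := SL2N0_ge0 g 0 0; have b0 := SL2N0_ge0 g 0 1.
have c0 := SL2N0_ge0 g 1 0; have d0 := SL2N0_ge0 g 1 1.
move: (g 0 0) (g 0 1) (g 1 0) (g 1 1) a0 b0 c0 d0 gE
  => a b c d a0 b0 c0 d0 gE det1.
have [/andP[ca db]|] := boolP ((c <= a) && (d <= b)).
  right; exists Right.
  have [|||||h hE] := @SL2N0_mx22 (a - c) (b - d) c d; try lia.
  exists h; do 2!apply: val_inj; rewrite /= gE hE mulmx22.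
  by congr mx22; ring.
have [/andP[ac bd] _|] := boolP ((a <= c) && (b <= d)).
  right; exists Left.
  have [|||||h hE] := @SL2N0_mx22 a b (c - a) (d - b); try lia.
  exists h; do 2!apply: val_inj; rewrite /= gE hE mulmx22.
  by congr mx22; ring.
move=> nac nca; left.
have [ltca ltbd] : c + 1 <= a /\ b + 1 <= d.
  have [lt_ca|le_ac] := ltP c a; first by lia.
  by have : a * d <= b * c; [rewrite mulrC; apply: ler_pM; lia | lia].
have : (c + 1) * (b + 1) <= a * d by apply: ler_pM; lia.
rewrite mulrDl mulrDr !mulr1 mul1r => le_ad.
have [b1 c1] : b = 0 /\ c = 0 by lia.
have [a1 d1] : a = 1 /\ d = 1 by nia.
do 2!apply: val_inj; rewrite /= gE b1 c1 a1 d1 [RHS]mx22E.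
by congr mx22; rewrite !mxE.
Qed.

(** * The orbit map *)

Lemma SL2N0_actE (g : SL2N0) z : SL2N0_act g z = mobius g z.
Proof. exact: PSL2Z_actE. Qed.

Lemma SL2N0_actM (g h : SL2N0) z :
  SL2N0_act (g * h)%g z = SL2N0_act g (SL2N0_act h z).
Proof. by rewrite !SL2N0_actE -mobiusM. Qed.

Lemma SL2N0_row0_gt0 (g : SL2N0) : 0 < (g 0 0 + g 0 1)%:~R :> rat.
Proof.
rewrite ltr0z; have := SL2Z_det_int g.
have := SL2N0_ge0 g 0 0; have := SL2N0_ge0 g 0 1.
rewrite !le0r => /orP[/eqP->|?] /orP[/eqP->|?]; lia.
Qed.

Lemma SL2N0_row1_gt0 (g : SL2N0) : 0 < (g 1 0 + g 1 1)%:~R :> rat.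
Proof.
rewrite ltr0z; have := SL2Z_det_int g.
have := SL2N0_ge0 g 1 0; have := SL2N0_ge0 g 1 1.
rewrite !le0r => /orP[/eqP->|?] /orP[/eqP->|?]; lia.
Qed.

Definition orbit_map (g : SL2N0) : Qpos :=
  MkQpos (divr_gt0 (SL2N0_row0_gt0 g) (SL2N0_row1_gt0 g)).

Lemma orbit_mapE (g : SL2N0) : SL2N0_act g (Some 1) = Some (orbit_map g : rat).
Proof.
have := SL2N0_row1_gt0 g; rewrite SL2N0_actE /mobius /= !mulr1 !rmorphD /=.
by move/gt_eqF ->.
Qed.

(** The reason why the two graphs agree: the Moebius action of a generator is
    the passage to the corresponding child. *)
Lemma gen_act (s : side) (x : Qpos) :
  SL2N0_act (gen s) (Some (x : rat)) = Some (child_label s x : rat).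
Proof.
have x0 := Qpos_gt0 x.
rewrite SL2N0_actE; case: s;
  rewrite /child_label (left_labelE, right_labelE) /mobius !mxE /=.
  by rewrite !mul1r addr0 gt_eqF ?addr_gt0.
by rewrite mul0r add0r oner_eq0 mul1r divr1.
Qed.

Lemma orbit_gen (s : side) (g : SL2N0) :
  orbit_map (gen s * g)%g = child_label s (orbit_map g).
Proof.
apply: val_inj; apply: Some_inj.
by rewrite -[LHS]orbit_mapE SL2N0_actM orbit_mapE gen_act.
Qed.

Lemma orbit1 : orbit_map 1%g = root_label.
Proof.
apply: val_inj; apply: Some_inj.
by rewrite -[LHS]orbit_mapE SL2N0_actE mobius1.
Qed.

Lemma orbit_path_mx (w : node) : orbit_map (path_mx w) = label w.
Proof.
by elim: w => [|s w IHw]; rewrite ?orbit1 // label_cons orbit_gen IHw.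
Qed.

(** The last step of the path is read off from the orbit point, and determines
    which generator can be split off on the left. *)
Lemma orbit_eq_label (g : SL2N0) (w : node) :
  orbit_map g = label w -> g = path_mx w.
Proof.
elim: w g => [|s w IHw] g; case: (SL2N0_case g) => [->|[t [h ->]]] //.
- by rewrite orbit_gen => /child_label_neq_root.
- by rewrite orbit1 label_cons => /esym/child_label_neq_root.
- by rewrite orbit_gen label_cons => /child_label_inj[-> /IHw ->].
Qed.

Lemma orbit_mapK : cancel orbit_map (path_mx \o node_of).
Proof. by move=> g; rewrite /= -(@orbit_eq_label g) // node_ofK. Qed.

Lemma orbit_map_bij : bijective orbit_map.
Proof.
exists (path_mx \o node_of); first exact: orbit_mapK.
by move=> x; rewrite /= orbit_path_mx node_ofK.
Qed.

(** * The correspondence between edges *)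

Lemma gen_in (s : side) : gen s \in pred2 L R.
Proof. by case: s; rewrite !inE eqxx ?orbT. Qed.

Definition gen_sub (s : side) : {A : SL2N0 | A \in pred2 L R} :=
  exist _ (gen s) (gen_in s).

Definition side_of (A : {A : SL2N0 | A \in pred2 L R}) : side :=
  if val A == L then Left else Right.

(** Left and right labels are distinct, so [L] and [R] are. *)
Lemma gen_inj : injective gen.
Proof.
move=> s t e.
by have [] : s = t /\ root_label = root_label
  by apply: child_label_inj; rewrite -orbit1 -!orbit_gen e.
Qed.

Lemma side_ofK : cancel side_of gen_sub.
Proof.
move=> A; apply: val_inj; rewrite /= /side_of; have := valP A; rewrite inE /=.
by case: eqP => [->|_ /eqP ->].
Qed.

Lemma gen_subK : cancel gen_sub side_of.
Proof.
by move=> s; apply: gen_inj; rewrite -[LHS]/(val (gen_sub _)) side_ofK.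
Qed.

Theorem proposition2p7 :
  exists Omega : SL2N0 -> Qpos,
    [/\ forall g : SL2N0, SL2N0_act g (Some 1) = Some (Qpos_rat (Omega g)),
        bijective Omega
      & exists OmegaE :
          edge (@cayley_digraph SL2N0 (pred2 L R)) -> edge calkin_wilf_digraph,
          @digraph_isomorphism (@cayley_digraph SL2N0 (pred2 L R))
            calkin_wilf_digraph Omega OmegaE].
Proof.
exists orbit_map; split; [exact: orbit_mapE | exact: orbit_map_bij |].
exists (fun e => (node_of (orbit_map e.1), side_of e.2)).
split; first exact: orbit_map_bij.
- exists (fun e => (path_mx e.1, gen_sub e.2)) => [[g A]|[w s]] /=.
    by rewrite side_ofK; congr (_, _); exact: orbit_mapK.
  by rewrite orbit_path_mx labelK gen_subK.
- by case=> g A; rewrite /= node_ofK.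
- case=> g A; rewrite [LHS]label_cons node_ofK -orbit_gen.
  by rewrite -[RHS]/(orbit_map (val A * g)%g) -[in RHS](side_ofK A).
Qed.
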